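(* Let $I\subseteq\mathbb{R}$ be an interval and let $f:I\to\mathbb{R}$ be such that $f'':I\to\mathbb{R}$ is an absolutely continuous function on the interior $I^{\circ}$ and $f'''\in L[a,b]$, where $a,b\in I$, $a<b$. Let $q>1$ and let $p$ satisfy $\frac{1}{p}+\frac{1}{q}=1$. If $|f'''|^{q}$ belongs to $Q(I)$, then $$\left|\frac{f(a)+f(b)}{2}-\frac{1}{b-a}\int_{a}^{b}f(x)\,dx-\frac{b-a}{12}\left[f'(b)-f'(a)\right]\right|\leq \frac{(b-a)^{3}}{24}\left(\frac{1}{(p+1)(p+3)}\right)^{\frac{1}{p}}\left[|f'''(a)|^{q}+|f'''(b)|^{q}\right]^{\frac{1}{q}}.$$
   Context: Godunova-Levin class: a map $g:I\to\mathbb{R}$ is said to belong to the class $Q(I)$ if it is nonnegative and for all $x,y\in I$ and $\lambda\in(0,1)$ it satisfies $g(\lambda x+(1-\lambda)y)\leq \frac{g(x)}{\lambda}+\frac{g(y)}{1-\lambda}$. $L[a,b]$ denotes the space of Lebesgue integrable functions on $[a,b]$. *)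

(* Defs.v *)
From HB Require Import structures.
From mathcomp Require Export all_boot all_order all_algebra.
From mathcomp Require Export all_classical all_reals all_analysis.
Export Order.TTheory GRing.Theory Num.Theory.
Export numFieldNormedType.Exports.

Set Implicit Arguments.
Unset Strict Implicit.
Unset Printing Implicit Defensive.

Local Open Scope classical_set_scope.
Local Open Scope ring_scope.

(* Real functions on an interval I are total functions R -> R of which only the
   values on I are constrained.  The difference quotient at x ranges over the
   points of I, so the derivative is one-sided at an endpoint of I that belongs
   to I, and two-sided at interior points. *)
Definition has_derivative_within (R : realType) (I : set R) (f : R -> R)
    (x l : R) : Prop :=
  (f y - f x) / (y - x) @[y --> within I x^'] --> l.

Definition derivative_on (R : realType) (I : set R) (f f' : R -> R) : Prop :=
  forall x, I x -> has_derivative_within I f x (f' x).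

(* f' is the derivative of f wherever that derivative exists.  Intended for f
   only almost everywhere differentiable on I (e.g. absolutely continuous): f'
   is then a function defined on all of I, with unspecified values at the
   points where f is not differentiable. *)
Definition derivative_where_exists (R : realType) (I : set R) (f f' : R -> R)
    : Prop :=
  forall x l, I x -> has_derivative_within I f x l -> f' x = l.

Definition absolutely_continuous_on (R : realType) (A : set R) (f : R -> R)
    : Prop :=
  forall e : R, 0 < e -> exists2 d : R, 0 < d &
    forall (n : nat) (u v : 'I_n -> R),
      (forall i, u i <= v i) ->
      (forall i, `[u i, v i] `<=` A) ->
      trivIset setT (fun i => `]u i, v i[%classic) ->
      \sum_(i < n) (v i - u i) < d ->
      \sum_(i < n) `|f (v i) - f (u i)| < e.

(* The Godunova-Levin class Q(I). *)
Definition godunova_levin (R : realType) (I : set R) (g : R -> R) : Prop :=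
  (forall x, I x -> 0 <= g x) /\
  (forall x y t : R, I x -> I y -> 0 < t -> t < 1 ->
     g (t * x + (1 - t) * y) <= g x / t + g y / (1 - t)).

(* Main.v *)
Require Import Defs.
From HB Require Import structures.
From mathcomp Require Import ring lra measurable_realfun.

Set Implicit Arguments.
Unset Strict Implicit.
Unset Printing Implicit Defensive.

Local Open Scope classical_set_scope.
Local Open Scope ring_scope.

(** With m = (a + b) / 2 and z = x - m, the kernel
    k(x) = (z^3 - ((b - a) / 2)^2 z) / 6 vanishes at a and b, and integrating
    k f''' by parts three times gives (b - a) times the quantity to be bounded.
    The Godunova-Levin inequality bounds |f'''|^q on ]a, b[ by an explicit
    function, so all that is needed of f''' is a local Lipschitz bound on f''.
    This bound is where absolute continuity enters: by the Jordan decomposition,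
    Radon-Nikodym and Lebesgue differentiation, an absolutely continuous function
    whose derivative is bounded by c wherever it exists is c-Lipschitz.
    The boundary form k f'' - k' f' + k'' f - \int f is then compared with an
    explicit function through a mean value inequality for right Dini
    derivatives.  That function comes from Young's inequality
    |z| |f'''| <= alpha |z|^p + beta |f'''|^q inside the integral, and optimising
    the weights recovers the constant given by Hoelder's inequality. *)

(** * Absolute continuity and total variation *)

(** Lists, unlike families indexed by ['I_n], can be refined, permuted and concatenated by
    induction. Degenerate intervals are allowed, but not strictly inside another interval. *)
Definition nonoverlapping (R : realType) (u v : R) (s : seq (R * R)) : bool :=
  all (fun I => [&& u <= I.1, I.1 <= I.2 & I.2 <= v]) s &&
  pairwise (fun I J => (I.2 <= J.1) || (J.2 <= I.1)) s.

Definition ac_itv (R : realType) (u v : R) (F : R -> R) : Prop :=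
  forall e : R, 0 < e -> exists2 d : R, 0 < d &
    forall s, nonoverlapping u v s ->
      \sum_(I <- s) (I.2 - I.1) < d -> \sum_(I <- s) `|F I.2 - F I.1| < e.

Section nonoverlapping_intervals.
Context {R : realType}.
Implicit Types (u v x y d e : R) (F G h : R -> R) (s : seq (R * R)).

(** Positions in the list serve as indices; a point common to two of the open intervals would
    contradict the order of their endpoints. *)
Lemma absolutely_continuous_on_itv (A : set R) h u v :
  `[u, v] `<=` A -> absolutely_continuous_on A h -> ac_itv u v h.
Proof.
move=> uvA hac e e0; have [d d0 hd] := hac e e0; exists d => // s.
move=> /andP[/allP sin /(pairwiseP (0, 0)) sdisj] sd.
pose lo (i : 'I_(size s)) := (nth (0, 0) s i).1.
pose hi (i : 'I_(size s)) := (nth (0, 0) s i).2.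
have inI (i : 'I_(size s)) : [&& u <= lo i, lo i <= hi i & hi i <= v].
  by apply: sin; exact: mem_nth.
move: sd; rewrite (big_nth (0, 0)) big_mkord => sd.
rewrite (big_nth (0, 0)) big_mkord.
apply: (hd _ lo hi) => // [i|i|].
- by case/and3P: (inI i).
- move=> x /=; rewrite in_itv/= => /andP[lx xh]; apply: uvA => /=.
  case/and3P: (inI i) => ul _ hv.
  by rewrite in_itv/= (le_trans ul lx) (le_trans xh hv).
- have aux (i j : 'I_(size s)) x : (i < j)%N -> lo i < x < hi i ->
      lo j < x < hi j -> False.
    move=> ij /andP[ix xi] /andP[jx xj].
    have /orP[] := sdisj i j (ltn_ord i) (ltn_ord j) ij;
      rewrite -/(hi i) -/(lo j) -/(hi j) -/(lo i); lra.
  move=> i j _ _ [x [/=]]; rewrite !in_itv/= => xi xj.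
  have [ij|ji|/val_inj//] := ltngtP i j; exfalso.
  + exact: aux ij xi xj.
  + exact: aux ji xj xi.
Qed.

Lemma pairmap_path_nonoverlapping x y (t : seq R) :
  itv_partition x y t -> nonoverlapping x y (pairmap pair x t).
Proof.
rewrite /nonoverlapping.
elim: t x => [//|z t IH] x [/= /andP[xz zt] /eqP tl].
have zty : itv_partition z y t by split=> //; apply/eqP.
have zy : z <= y by exact: itv_partition_le zty.
case/andP: (IH _ zty) => tin tdisj.
rewrite lexx (ltW xz) zy tdisj !andbT/=; move/allP in tin; apply/andP; split.
  apply/allP => I /tin/and3P[zI -> ->].
  by rewrite (le_trans (ltW xz) zI).
by apply/allP => I /tin/and3P[-> _ _].
Qed.

Lemma variation_pairmap x y (t : seq R) h : itv_partition x y t ->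
  variation x y h t = \sum_(I <- pairmap pair x t) `|h I.2 - h I.1|.
Proof.
move=> xyt; rewrite (variation_zip h xyt) {xyt}.
elim: t x => [|z t IH] x /=; first by rewrite !big_nil.
by rewrite !big_cons -IH.
Qed.

Lemma sum_pairmap_length x y (t : seq R) : itv_partition x y t ->
  \sum_(I <- pairmap pair x t) (I.2 - I.1) = y - x.
Proof.
move=> [_ /eqP <-].
elim: t x => [|z t IH] x /=; first by rewrite big_nil subrr.
by rewrite big_cons IH/=; lra.
Qed.

(** The separation relation is symmetric, so blocks may be exchanged; this lets a refined head be
    moved into the tail. *)
Lemma nonoverlapping_catCA u v s1 s2 s3 :
  nonoverlapping u v (s1 ++ s2 ++ s3) = nonoverlapping u v (s2 ++ s1 ++ s3).
Proof.
rewrite /nonoverlapping !all_cat !pairwise_cat !allrel_catr.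
have -> : allrel (fun I J : R * R => (I.2 <= J.1) || (J.2 <= I.1)) s1 s2 =
          allrel (fun I J : R * R => (I.2 <= J.1) || (J.2 <= I.1)) s2 s1.
  by rewrite allrelC; apply: eq_allrel => I J; rewrite orbC.
do ![case: (all _ _) => //]; do ![case: (pairwise _ _) => //]; do ![case: (allrel _ _ _)=> //].
Qed.

Lemma nonoverlapping_refine u v x y (t : seq R) s :
  itv_partition x y t -> nonoverlapping u v ((x, y) :: s) ->
  nonoverlapping u v (pairmap pair x t ++ s).
Proof.
move=> /pairmap_path_nonoverlapping/andP[/allP tin tdisj].
rewrite /nonoverlapping/= all_cat pairwise_cat tdisj/=.
move=> /andP[/andP[/and3P[ux xy yv] ->] /andP[/allP xys ->]].
rewrite !andbT; apply/andP; split.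
  apply/allP => I /tin/and3P[xI -> Iy].
  by rewrite (le_trans ux xI) (le_trans Iy yv).
apply/allrelP => I J /tin/and3P[xI _ Iy] /xys/= /orP[yJ|Jx].
  by rewrite (le_trans Iy yJ).
by rewrite (le_trans Jx xI) orbT.
Qed.

(* Each interval of s is traded for a partition of it, absorbed into t. *)
Lemma sum_total_variation_le u v h d e : 
  (forall s, nonoverlapping u v s -> \sum_(I <- s) (I.2 - I.1) < d ->
     \sum_(I <- s) `|h I.2 - h I.1| <= e) ->
  forall s (t : seq (R * R)), nonoverlapping u v (s ++ t) ->
    \sum_(I <- s ++ t) (I.2 - I.1) < d ->
    (\sum_(I <- s) total_variation I.1 I.2 h +
     (\sum_(I <- t) `|h I.2 - h I.1|)%:E <= e%:E)%E.
Proof.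
move=> hd; elim=> [|[x y] s IH] t.
  by rewrite big_nil add0e lee_fin => /hd /[apply].
move=> no; rewrite big_cons/= => len; rewrite big_cons -addeA/=.
have xy : x <= y by case/andP: no => /= /andP[/and3P[]].
set S := (X in (_ + X <= _)%E).
have HS (t' : seq R) : itv_partition x y t' -> ((variation x y h t')%:E + S <= e%:E)%E.
  move=> xyt; rewrite /S addeCA (variation_pairmap _ xyt) -EFinD -big_cat/=.
  apply: IH.
    by rewrite nonoverlapping_catCA; exact: nonoverlapping_refine no.
  move: len; rewrite !big_cat/= (sum_pairmap_length xyt).
  by rewrite addrCA.
have S0 : (0 <= S)%E.
  apply: adde_ge0; last by rewrite lee_fin sumr_ge0.
  rewrite big_seq; apply: sume_ge0 => I Is; apply: total_variation_ge0.
  case/andP: no => /= /andP[_ /allP/(_ I)] + _.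
  by rewrite mem_cat Is => /(_ isT)/and3P[].
(* [[:: y]] is a partition only when [x < y], so a degenerate head is treated apart. *)
move: xy; rewrite le_eqVlt => /predU1P[xy|xy].
  rewrite xy total_variationxx add0e; apply: IH.
    by case/andP: no => /= /andP[_ nos] /andP[_ nos']; rewrite /nonoverlapping nos.
  by move: len; rewrite xy subrr add0r.
(* Finiteness of [S] allows it to be subtracted before passing to the supremum over partitions of
   [[x, y]]. *)
have Sfin : S \is a fin_num.
  rewrite ge0_fin_numE// (@le_lt_trans _ _ e%:E) ?ltry//.
  apply: le_trans (HS [:: y] _); last exact: itv_partition1.
  by rewrite leeDr// lee_fin variation_ge0.
rewrite -leeBrDr//; apply: ge_ereal_sup => _ [_ [t' xyt <-] <-].
by rewrite leeBrDr// HS.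
Qed.

End nonoverlapping_intervals.

Section total_variation.
Context {R : realType}.
Implicit Types (u v x y d e : R) (F G h : R -> R) (s : seq (R * R)).
Local Notation TV := total_variation.

Lemma nonoverlapping1 u v x y : u <= x -> x <= y -> y <= v ->
  nonoverlapping u v [:: (x, y)].
Proof. by move=> ux xy yv; rewrite /nonoverlapping/= ux xy yv. Qed.

(** On an interval shorter than the [d] attached to [e = 1] the variation is at most 1, and finitely
    many steps of length [d / 2] exhaust [[u, v]]. *)
Lemma ac_itv_bounded_variation u v h : u <= v -> ac_itv u v h ->
  bounded_variation u v h.
Proof.
move=> uv /(_ 1 ltr01)[d d0 hd].
have short x y : u <= x -> x <= y -> y <= v -> y - x < d ->
    (TV x y h <= 1%:E)%E.
  move=> ux xy yv yxd.
  have hd' s : nonoverlapping u v s -> \sum_(I <- s) (I.2 - I.1) < d ->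
      \sum_(I <- s) `|h I.2 - h I.1| <= 1 by move=> /hd /[apply] /ltW.
  have := sum_total_variation_le hd' (s := [:: (x, y)]) (t := [::]).
  rewrite !big_cons !big_nil/= adde0 addr0 adde0; apply => //.
  exact: nonoverlapping1.
suff H n y : u <= y -> y <= v -> y - u < n%:R * (d / 2) -> (TV u y h < +oo)%E.
  apply/(bounded_variationP _ uv).
  rewrite ge0_fin_numE ?total_variation_ge0//.
  apply: (H (Num.bound ((v - u) / (d / 2)))) => //.
  by rewrite -ltr_pdivrMr ?divr_gt0// archi_boundP// divr_ge0; lra.
elim: n y => [|n IH] y uy yv; first by rewrite mul0r => ?; exfalso; lra.
move=> yn; have [yd|dy] := ltP (y - u) d.
  by rewrite (le_lt_trans (short _ _ (lexx u) uy yv yd)) ?ltry.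
have uz : u <= y - d / 2 by lra.
have zy : y - d / 2 <= y by lra.
rewrite (total_variationD h uz zy) lte_add_pinfty//.
  apply: IH => //; first lra.
  by move: yn; rewrite -[n.+1%:R]natr1; lra.
by rewrite (le_lt_trans (short _ _ uz zy yv _)) ?ltry//; lra.
Qed.

Lemma fine_total_variationB u v x y h : bounded_variation u v h ->
  u <= x -> x <= y -> y <= v ->
  fine (TV u y h) - fine (TV u x h) = fine (TV x y h).
Proof.
move=> bv ux xy yv; rewrite (total_variationD h ux xy) fineD; last 2 first.
- apply/(bounded_variationP _ ux).
  exact: bounded_variationl ux (le_trans xy yv) bv.
- apply/(bounded_variationP _ xy).
  apply: (bounded_variationl xy yv).
  exact: bounded_variationr ux (le_trans xy yv) bv.
by rewrite addrAC subrr add0r.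
Qed.

(** Refining each interval preserves the total length, so a [d] for [h] also serves its variation.
    The supremum over refinements only yields a weak inequality, hence the use of [e / 2]. *)
Lemma ac_itv_total_variation u v h : u <= v -> ac_itv u v h ->
  ac_itv u v (fun x => fine (TV u x h)).
Proof.
move=> uv ach; have bv := ac_itv_bounded_variation uv ach.
move=> e e0; have [d d0 hd] := ach _ (divr_gt0 e0 (ltr0Sn _ 1)).
exists d => // s nos sd.
have hd' t : nonoverlapping u v t -> \sum_(I <- t) (I.2 - I.1) < d ->
      \sum_(I <- t) `|h I.2 - h I.1| <= e / 2 by move=> /hd /[apply] /ltW.
have := sum_total_variation_le hd' (s := s) (t := [::]).
rewrite cats0 big_nil adde0 => /(_ nos sd) le_e.
apply: (@le_lt_trans _ _ (e / 2)); last by lra.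
rewrite -lee_fin -sumEFin; apply: le_trans le_e.
rewrite big_seq [leRHS]big_seq; apply: lee_sum => -[x y] xys /=.
case/andP: nos => /allP/(_ _ xys)/and3P[/= ux xy yv] _.
have xyfin : TV x y h \is a fin_num.
  apply/(bounded_variationP _ xy); apply: (bounded_variationl xy yv).
  exact: bounded_variationr ux (le_trans xy yv) bv.
rewrite (fine_total_variationB bv ux xy yv) ger0_norm ?fineK//.
by rewrite fine_ge0// total_variation_ge0.
Qed.

Lemma ac_itvB u v F G : ac_itv u v F -> ac_itv u v G ->
  ac_itv u v (fun x => F x - G x).
Proof.
move=> acF acG e e0; have e20 : 0 < e / 2 by rewrite divr_gt0.
have [d1 d10 Fd] := acF _ e20; have [d2 d20 Gd] := acG _ e20.
exists (Num.min d1 d2); first by rewrite lt_min d10 d20.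
move=> s nos; rewrite lt_min => /andP[sd1 sd2].
apply: (@le_lt_trans _ _ (\sum_(I <- s) (`|F I.2 - F I.1| + `|G I.2 - G I.1|))).
  apply: ler_sum => I _.
  rewrite (_ : _ - _ = (F I.2 - F I.1) - (G I.2 - G I.1)); last by ring.
  exact: ler_normB.
by rewrite big_split/=; have := Fd _ nos sd1; have := Gd _ nos sd2; lra.
Qed.

(** Jordan decomposition [h = V - (V - h)], where [V] is the variation of [h] from [u]. Both parts
    stay absolutely continuous, so each of them will define a measure dominated by Lebesgue
    measure. *)
Lemma ac_itv_monotone_decomposition u v h : u <= v -> ac_itv u v h ->
  exists F G, [/\ ac_itv u v F, ac_itv u v G,
    {in `[u, v] &, nondecreasing_fun F}, {in `[u, v] &, nondecreasing_fun G} &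
    forall x, h x = F x - G x].
Proof.
move=> uv ach; have bv := ac_itv_bounded_variation uv ach.
have acV := ac_itv_total_variation uv ach.
exists (fun x => fine (TV u x h)), (fun x => fine (TV u x h) - h x).
split => //; first exact: ac_itvB.
- move=> x y; rewrite !in_itv/= => /andP[ux xv] /andP[uy yv] xy.
  rewrite -subr_ge0 (fine_total_variationB bv ux xy yv).
  by rewrite fine_ge0// total_variation_ge0.
- move=> x y; rewrite !in_itv/= => /andP[ux xv] /andP[uy yv] xy.
  have := fine_total_variationB bv ux xy yv.
  have xyfin : TV x y h \is a fin_num.
    apply/(bounded_variationP _ xy); apply: (bounded_variationl xy yv).
    exact: bounded_variationr ux xv bv.
  have := total_variation_ge h xy.
  rewrite -(fineK xyfin) lee_fin; have := ler_norm (h y - h x); lra.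
- by move=> x; lra.
Qed.

End total_variation.

(** * Absolutely continuous functions as integrals *)

Section integral_representation.
Context {R : realType}.
Implicit Types (u v x y c d e l : R) (F G h : R -> R) (s : seq (R * R)).
Local Notation mu := (@lebesgue_measure R).

(** The projection onto [[u, v]]: it is monotone and 1-Lipschitz, so composing with it extends a
    function on [[u, v]] to the line and keeps its monotonicity and continuity. *)
Definition clamp u v x : R := Num.max u (Num.min v x).

Lemma clamp_in u v x : u <= v -> u <= clamp u v x <= v.
Proof. by move=> uv; rewrite /clamp le_max ge_max lexx uv ge_min lexx. Qed.

Lemma clamp_id u v x : u <= x <= v -> clamp u v x = x.
Proof. by move=> /andP[ux xv]; rewrite /clamp min_r// max_r. Qed.

Lemma clamp_le u v : {homo clamp u v : x y / x <= y}.
Proof.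
move=> x y xy; by rewrite /clamp ge_max !le_max lexx/= le_min !ge_min lexx/= xy !orbT.
Qed.

Lemma clampB_le u v x y : x <= y -> clamp u v y - clamp u v x <= y - x.
Proof.
move=> xy; rewrite /clamp; case: (leP v x); case: (leP v y) => *.
all: by do ?[case: (leP u _) => *]; lra.
Qed.

(** Finite measure excludes rays and the whole line, and an open interval equals its interior, whose
    bounds are open. *)
Lemma bounded_open_interval (J : set R) : open J -> is_interval J ->
  (mu J < +oo)%E -> J !=set0 -> exists I : R * R, I.1 < I.2 /\ J = `]I.1, I.2[%classic.
Proof.
move=> oJ /is_intervalP; move: (Rhull J) => i JE; move: oJ; rewrite {}JE.
move=> oi ioo [z /= zi]; move: oi ioo zi; rewrite lebesgue_measure_itv.
case: i => -[p x|[]] [q y|[]] //= oi; rewrite ?in_itv/= ?ltey ?ltNye ?andbF//=.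
have JE : [set` Interval (BSide p x) (BSide q y)] = `]x, y[%classic.
  by rewrite -(interior_itv_bnd x y p q); apply/esym/interior_id.
move=> _ zJ; exists (x, y); split => //=.
have : `]x, y[%classic z by rewrite -JE /= in_itv.
by rewrite /= in_itv/= => /andP[]; exact: lt_trans.
Qed.

Lemma ac_itv_continuous u v F x e : ac_itv u v F -> 0 < e ->
  exists2 d, 0 < d & forall x y, u <= x <= v -> u <= y <= v -> `|y - x| < d ->
    `|F y - F x| < e.
Proof.
move=> acF e0; have [d d0 hd] := acF _ e0; exists d => // {}x y.
wlog xy : x y / x <= y.
  move=> wl xuv yuv xyd; have [xy|/ltW yx] := leP x y; first exact: wl.
  by rewrite distrC; apply: wl => //; rewrite distrC.
move=> /andP[ux xv] /andP[uy yv] xyd.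
have := hd _ (nonoverlapping1 ux xy yv).
by rewrite !big_cons !big_nil !addr0/=; apply; rewrite (le_lt_trans (ler_norm _)).
Qed.

(** * The Stieltjes measure of a nondecreasing absolutely continuous function *)

Section stieltjes.
Variables (u v : R) (F : R -> R).
Hypotheses (uv : u <= v) (acF : ac_itv u v F)
  (ndF : {in `[u, v] &, nondecreasing_fun F}).

Let Fc x := F (clamp u v x).

Let Fc_nd : nondecreasing Fc.
Proof.
move=> x y xy; apply: ndF; rewrite ?in_itv/= ?clamp_in//; exact: clamp_le.
Qed.

Let Fc_rc : right_continuous Fc.
Proof.
apply: right_continuousW => x; apply/cvgrPdist_lt => e e0.
have [d d0 hd] := ac_itv_continuous x acF e0.
near=> y; apply: hd; rewrite ?clamp_in//.
have xy : `|x - y| < d by near: y; exact: cvgr_dist_lt.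
apply: le_lt_trans xy.
have [yx|/ltW xy] := leP y x.
  rewrite !ger0_norm ?subr_ge0//; [exact: clampB_le|exact: clamp_le].
rewrite distrC [leRHS]distrC.
rewrite !ger0_norm ?subr_ge0//; [exact: clampB_le|exact: clamp_le].
Unshelve. all: by end_near. Qed.

(* F extended by constants outside [u, v]. *)
Definition clamped_cumulative : cumulative R R :=
  HB.pack Fc (isCumulative.Build R _ R Fc Fc_nd Fc_rc).

Let nu := lebesgue_stieltjes_measure clamped_cumulative.

Let nu_oc x y : x <= y -> nu `]x, y]%classic = (Fc y - Fc x)%:E.
Proof.
move=> xy; rewrite /nu /lebesgue_stieltjes_measure /measure_extension.
by rewrite measurable_mu_extE/=; [rewrite wlength_itv_bnd|exact: is_ocitv].
Qed.

Let Fc_ge x : F u <= Fc x.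
Proof.
have /andP[ux xv] := clamp_in x uv.
by apply: ndF; rewrite ?in_itv/= ?lexx ?ux.
Qed.

Let Fc_le x : Fc x <= F v.
Proof.
have /andP[ux xv] := clamp_in x uv.
by apply: ndF; rewrite ?in_itv/= ?lexx ?ux ?uv.
Qed.

Let nu_setT : (nu setT <= (F v - F u)%:E)%E.
Proof.
rewrite -(bigcup_itvT false false).
pose I n : set R := `]- (n%:R), n%:R]%classic.
have cvg_nu : (nu \o I) n @[n --> \oo] --> nu (\bigcup_n I n).
  apply: nondecreasing_cvg_mu; rewrite /I//; first exact: bigcup_measurable.
  by move=> *; apply/subsetPset/subset_itv; rewrite leBSide/= ?lerN2 ler_nat.
rewrite -(cvg_lim _ cvg_nu)//; apply: lime_le; first by apply/cvg_ex; eexists; exact: cvg_nu.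
apply: nearW => n /=; rewrite /I nu_oc; last by rewrite ge0_cp.
by rewrite lee_fin lerB.
Qed.

Let nu_fin : fin_num_fun nu.
Proof.
move=> A mA; rewrite ge0_fin_numE//.
apply: (@le_lt_trans _ _ (nu setT)); first by apply: le_measure; rewrite ?inE.
by rewrite (le_lt_trans nu_setT)// ltry.
Qed.

(** By outer regularity a null set lies in an open set of measure less than [d]. That set is a
    countable disjoint union of open intervals, and absolute continuity bounds by [e] the mass of
    any finitely many of them. *)
Let nu_dominated : nu `<< mu.
Proof.
apply/null_content_dominatesP => A mA A0.
apply/eqP; rewrite eq_le measure_ge0 andbT; apply/lee_addgt0Pr => e e0.
rewrite add0e.
have [d d0 hd] := acF e0.
have [|U [oU AU UA]] := lebesgue_regularity_outer mA _ d0.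
  by rewrite A0 ltry.
have mU : measurable U by exact: open_measurable.
have Ud : (mu U < d%:E)%E.
  rewrite -(setDUK AU) measureU//; [|exact: measurableD|by rewrite setDIK].
  by rewrite A0 add0e.
apply: (@le_trans _ _ (nu U)); first by apply: le_measure; rewrite ?inE.
pose J := open_disjoint_itv oU.
have mJ k : measurable (J k).
  by apply: open_measurable; exact: open_disjoint_itv_open.
have UJ : U = \bigcup_k J k by exact: open_disjoint_itv_bigcup.
have tJ : trivIset setT J by exact: open_disjoint_itv_trivIset.
have Joo k : (mu (J k) < d%:E)%E.
  apply: le_lt_trans Ud; apply: le_measure; rewrite ?inE.
  - exact: mJ.
  - exact: mU.
  - by rewrite UJ; exact: bigcup_sup.
(* An empty component is encoded by [(u, u)]: at the left end of [[u, v]], it lies before every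
   clamped interval. *)
have /choice[p pP] : forall k, exists p : R * R, [/\ p.1 <= p.2,
    J k = `]p.1, p.2[%classic & p.1 < p.2 \/ p = (u, u)].
  move=> k; have [J0|/set0P J0] := eqVneq (J k) set0.
    by exists (u, u); split; [|rewrite J0 set_itvoo0|right].
  have [||||q [q12 Jq]] := @bounded_open_interval (J k).
  - exact: open_disjoint_itv_open.
  - exact: open_disjoint_itv_is_interval.
  - by rewrite (lt_trans (Joo k)) ?ltry.
  - exact: J0.
  - by exists q; split; [exact: ltW| |left].
have muJ k : mu (J k) = ((p k).2 - (p k).1)%:E.
  have [p12 -> _] := pP k; rewrite lebesgue_measure_itv/= lte_fin.
  by case: ltP => // p21; rewrite (le_anti (introT andP (conj p12 p21))) subrr.
have nuJ k : (nu (J k) <= (Fc (p k).2 - Fc (p k).1)%:E)%E.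
  have [p12 -> _] := pP k; rewrite -nu_oc//.
  by apply: le_measure; rewrite ?inE//; exact: subset_itv_oo_oc.
(* Clamping the endpoints leaves the increments of [Fc] unchanged, brings the intervals into
   [[u, v]] and does not lengthen them. *)
pose s n := [seq (clamp u v (p k).1, clamp u v (p k).2) | k <- index_iota 0 n].
have nos n : nonoverlapping u v (s n).
  apply/andP; split.
    apply/allP => _ /mapP[k _ ->] /=; have [p12 _ _] := pP k.
    have /andP[-> _] := clamp_in (p k).1 uv.
    by have /andP[_ ->] := clamp_in (p k).2 uv; rewrite clamp_le.
  rewrite pairwise_map; apply: (@sub_pairwise _ (fun i j => i != j)).
    move=> i j ij /=.
    have clampu : clamp u v u = u by rewrite clamp_id// lexx.
    have [_ Ji [pi|->]] := pP i; last first.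
      by rewrite /= clampu; have /andP[-> _] := clamp_in (p j).1 uv.
    have [_ Jj [pj|->]] := pP j; last first.
      by rewrite /= clampu; have /andP[-> _] := clamp_in (p i).1 uv; rewrite orbT.
    have [ij'|ji] := leP (p i).2 (p j).1; first by rewrite clamp_le.
    have [ji'|ij'] := leP (p j).2 (p i).1; first by rewrite [X in _ || X]clamp_le ?orbT.
    exfalso; move/eqP : ij; apply; apply: tJ => //.
    (* The midpoint of the overlap is a common point of the two components. *)
    pose z := (Num.max (p i).1 (p j).1 + Num.min (p i).2 (p j).2) / 2.
    exists z; rewrite Ji Jj /= !in_itv/= /z.
    by case: (leP (p i).1 (p j).1) => ?; case: (leP (p i).2 (p j).2) => ?;
      split; apply/andP; split; lra.
  by rewrite -uniq_pairwise iota_uniq.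
have sd n : \sum_(I <- s n) (I.2 - I.1) < d.
  rewrite big_map; apply: (@le_lt_trans _ _ (\sum_(0 <= k < n) ((p k).2 - (p k).1))).
    by apply: ler_sum => k _ /=; have [p12 _ _] := pP k; exact: clampB_le.
  rewrite -lte_fin -sumEFin; apply: le_lt_trans Ud.
  rewrite UJ measure_semi_bigcup//; last by apply: bigcup_measurable => k _; exact: mJ.
  under eq_bigr do rewrite -muJ.
  exact: nneseries_lim_ge.
rewrite UJ /nu measure_semi_bigcup//; last by apply: bigcup_measurable => k _; exact: mJ.
apply: lime_le; first exact: is_cvg_nneseries.
apply: nearW => n.
apply: (@le_trans _ _ (\sum_(I <- s n) `|F I.2 - F I.1|)%:E); last first.
  by rewrite lee_fin ltW// hd.
rewrite big_map -sumEFin; apply: lee_sum => k _.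
by rewrite (le_trans (nuJ k))// lee_fin ler_norm.
Qed.

(** [g] is the Radon-Nikodym density of the Stieltjes measure of the clamped [F], and the formula is
    its integral over []u, x]], to which the point [u] adds nothing. *)
Lemma ac_itv_nondecreasing_integral : exists g : R -> R,
  mu.-integrable setT (EFin \o g) /\
  forall x, u <= x <= v -> F x = F u + \int[mu]_(t in `[u, x]) g t.
Proof.
pose nuf : {finite_measure set (measurableTypeR R) -> \bar R} :=
  HB.pack (lebesgue_stieltjes_measure clamped_cumulative)
    (@Measure_isFinite.Build _ _ _ (lebesgue_stieltjes_measure clamped_cumulative) nu_fin).
have [f [_ f_fin f_int nuf_int]] :=
  @radon_nikodym_sigma_finite _ _ _ mu nuf nu_dominated.
have fE : f = EFin \o (fine \o f) by apply/funext => x; rewrite /= fineK.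
exists (fine \o f); rewrite -fE; split => // x /andP[ux xv].
rewrite /Rintegral -[X in fine X]/(\int[mu]_(t in `[u, x]) ((EFin \o (fine \o f)) t))%E.
rewrite -fE -integral_itv_obnd_cbnd; last first.
  by apply: measurable_funTS; exact: measurable_int f_int.
rewrite -nuf_int// -[X in fine X]/(nu `]u, x]%classic) nu_oc//= /Fc !clamp_id ?ux ?xv ?lexx//.
by rewrite addrC subrK.
Qed.

End stieltjes.

(** [h] is the integral of a function [k], and Lebesgue differentiation makes [k] the derivative of
    [h] almost everywhere. The bound at points of differentiability thus bounds [k] almost
    everywhere. *)
Lemma ac_itv_derive_bound u v h c : u <= v -> 0 <= c -> ac_itv u v h ->
  (forall x (l : R), u < x < v -> is_derive x 1 h l -> `|l| <= c) ->
  `|h v - h u| <= c * (v - u).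
Proof.
rewrite le_eqVlt => /predU1P[-> _ _ _|uv c0 ach hc].
  by rewrite !subrr normr0 mulr0.
have [F [G [acF acG ndF ndG hE]]] := ac_itv_monotone_decomposition (ltW uv) ach.
have [f [f_int FE]] := ac_itv_nondecreasing_integral (ltW uv) acF ndF.
have [g [g_int GE]] := ac_itv_nondecreasing_integral (ltW uv) acG ndG.
pose k x := f x - g x.
have k_int : mu.-integrable setT (EFin \o k).
  by rewrite (_ : EFin \o k = (EFin \o f) \- (EFin \o g))%E//; exact: integrableB.
have k_intS (A : set R) : measurable A -> mu.-integrable A (EFin \o k).
  by move=> mA; apply: integrableS k_int.
have hintE x : u <= x <= v -> h x = h u + \int[mu]_(t in `[u, x]) k t.
  move=> uxv; rewrite !hE (FE _ uxv) (GE _ uxv) RintegralB//.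
  - by lra.
  - by apply: integrableS f_int.
  - by apply: integrableS g_int.
have kc : {ae mu, forall x, `]u, v[%classic x -> (`|(EFin \o k) x| <= c%:E)%E}.
  have := @FTC1 R k (BLeft u) (fun y => k_intS _ (measurable_itv _))
    (open_integrable_locally openT k_int).
  apply: filterS; first exact: (ae_filter_ringOfSetsType mu).
  move=> x /= kx; rewrite in_itv/= => /andP[ux xv].
  have [|dk kxE] := kx; first by rewrite lte_fin.
  rewrite lee_fin; apply: (hc x); first by rewrite ux.
  apply: (@near_eq_is_derive _ _ _ (fun y => h u + \int[mu]_(t in `[u, y]) k t)).
  - near=> y; apply/esym/hintE; apply/andP; split; apply/ltW; near: y.
    + exact: lt_nbhsr.
    + exact: lt_nbhsl.
  - rewrite -[k x]add0r; apply: is_deriveD; split => //.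
    by rewrite -derive1E.
rewrite (hintE v) ?lexx ?(ltW uv)// addrAC subrr add0r.
have fin : (\int[mu]_(t in `[u, v]) (k t)%:E)%E \is a fin_num.
  by apply: integrable_fin_num => //; exact: k_intS.
rewrite /Rintegral -lee_fin -abse_EFin fineK//.
apply: le_trans (le_abse_integral _ _ _) _ => //.
  by apply: measurable_int (k_intS _ _).
have mk (A : set R) : measurable A -> measurable_fun A (fun t => `|(k t)%:E|)%E.
  by move=> mA; apply: measurableT_comp => //; exact: measurable_int (k_intS _ mA).
(* Both endpoints are removed, since the bound on [k] is stated on the open interval. *)
rewrite -integral_itv_obnd_cbnd; last exact: mk.
rewrite -integral_itv_bndo_bndc; last exact: mk.
apply: le_trans (ae_ge0_le_integral _ _ _ _ _ kc) _ => //.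
- exact: mk.
- by rewrite integral_cst//= lebesgue_measure_itv/= lte_fin uv.
Unshelve. all: by end_near. Qed.

End integral_representation.

(** * Dini derivatives *)

Section dini.
Context {R : realType}.
Implicit Types (a b u v x y c d e l : R) (f g phi psi H : R -> R).
Local Notation mu := (@lebesgue_measure R).

Lemma within_continuous_dist (A : set R) f x e :
  {within A, continuous f} -> A x -> 0 < e ->
  exists2 d, 0 < d & forall y, A y -> `|y - x| < d -> `|f y - f x| < e.
Proof.
move=> /subspace_continuousP /[apply] /cvgrPdist_lt /[apply].
rewrite near_withinE => /nbhs_ballP[d /= d0 hd]; exists d => // y Ay xy.
by rewrite distrC; apply: hd => //; rewrite /ball/= distrC.
Qed.

Lemma within_continuousB (A : set R) f g : {within A, continuous f} ->
  {within A, continuous g} -> {within A, continuous (fun x => f x - g x)}.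
Proof.
move=> cf cg x.
exact: (@continuousB _ _ (subspace A) _ _ _ (cf x) (cg x)).
Qed.

Lemma within_continuousD (A : set R) f g : {within A, continuous f} ->
  {within A, continuous g} -> {within A, continuous (fun x => f x + g x)}.
Proof.
move=> cf cg x.
exact: (@continuousD _ _ (subspace A) _ _ _ (cf x) (cg x)).
Qed.

Lemma within_continuousM (A : set R) f g : {within A, continuous f} ->
  {within A, continuous g} -> {within A, continuous (fun x => f x * g x)}.
Proof.
move=> cf cg x.
exact: (@continuousM _ (subspace A) _ _ _ (cf x) (cg x)).
Qed.

(** Otherwise let [s] be the infimum of the points where [phi] exceeds [phi u]. Continuity gives
    [phi s <= phi u], and then local decrease to the right of [s] leaves no such points near [s]. *)
Lemma right_nonincreasing_le u v phi : u <= v ->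
  {within `[u, v], continuous phi} ->
  (forall x, u <= x < v -> \forall y \near x^'+, phi y <= phi x) ->
  phi v <= phi u.
Proof.
move=> uv cphi dphi; rewrite leNgt; apply/negP => phiuv.
pose T := [set x | u <= x <= v /\ phi u < phi x].
have Tv : T v by split; rewrite ?uv ?lexx.
have infT : has_inf T by split; [exists v|exists u => x [/andP[]]].
pose s := inf T.
have us : u <= s by apply: lb_le_inf; [exists v|move=> x [/andP[]]].
have sv : s <= v by apply: ge_inf => //; case: infT.
have s_lt x : u <= x -> x < s -> phi x <= phi u.
  move=> ux xs; rewrite leNgt; apply/negP => Tx.
  have : s <= x by apply: ge_inf; [case: infT|split; rewrite ?ux//; lra].
  by rewrite leNgt xs.
have phis : phi s <= phi u.
  rewrite leNgt; apply/negP => Ts.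
  have u_lt_s : u < s by rewrite lt_neqAle us andbT; apply/eqP => E; move: Ts; rewrite -E ltxx.
  have [||d d0 hd] := @within_continuous_dist `[u, v] phi s (phi s - phi u) cphi.
  - by rewrite /= in_itv/= us.
  - by rewrite subr_gt0.
  pose y := Num.max u (s - d / 2).
  have uy : u <= y by rewrite le_max lexx.
  have ys : y < s by rewrite gt_max u_lt_s; lra.
  have yd : s - d / 2 <= y by rewrite le_max lexx orbT.
  have /hd hdy : [set` `[u, v]] y by rewrite /= in_itv/= uy; lra.
  have /hdy : `|y - s| < d by rewrite ltr_norml; apply/andP; split; lra.
  rewrite ltr_norml => /andP[].
  by have := s_lt _ uy ys; lra.
have s_lt_v : s < v.
  by rewrite lt_neqAle sv andbT; apply/eqP => E; move: phis; rewrite E; lra.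
have [|d /= d0 hd] := dphi s; first by rewrite us.
have [x [/andP[ux xv] Tx] xd] := inf_adherent d0 infT.
have sx : s <= x by apply: ge_inf; [case: infT|split; rewrite ?ux].
move: sx; rewrite le_eqVlt => /predU1P[E|sx]; first by move: Tx; rewrite -E; lra.
have : phi x <= phi s.
  by apply: hd => //; rewrite /ball/= ltr_norml; apply/andP; split; rewrite -/s in xd; lra.
lra.
Qed.

(** Subtracting a line turns the Dini condition into local decrease to the right. As the condition
    is given on the open interval, the argument starts from some [u > a], and continuity at [a]
    concludes. *)
Lemma right_dini_le a b phi : a <= b ->
  {within `[a, b], continuous phi} ->
  (forall x e, a < x < b -> 0 < e ->
     \forall y \near x^'+, phi y - phi x <= e * (y - x)) ->
  phi b <= phi a.
Proof.
rewrite le_eqVlt => /predU1P[->//|ab] cphi dphi.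
have in_le u : a < u < b -> phi b <= phi u.
  move=> /andP[au ub]; apply/ler_addgt0Pr => e e0.
  (* With this slope the line rises by exactly [e] over [[u, b]]. *)
  have bu0 : 0 < e / (b - u) by rewrite divr_gt0// subr_gt0.
  have : phi b - e / (b - u) * b <= phi u - e / (b - u) * u.
    apply: (@right_nonincreasing_le u b (fun x => phi x - e / (b - u) * x)) => //.
    - exact: ltW.
    - have : {within `[u, b], continuous phi}.
        by apply: continuous_subspaceW cphi; apply: subset_itvr; rewrite bnd_simp ltW.
      move=> cphiu; apply: within_continuousB => //.
      by apply: continuous_subspaceT => z; apply: cvgMr; exact: cvg_id.
    - move=> x /andP[ux xb].
      have xab : a < x < b by rewrite xb andbT; lra.
      apply: filterS (dphi _ _ xab bu0) => y; lra.
  have : e / (b - u) * b - e / (b - u) * u = e.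
    by rewrite -mulrBr divfK// subr_eq0 gt_eqF.
  lra.
apply/ler_addgt0Pr => e e0.
have [||d d0 hd] := @within_continuous_dist `[a, b] phi a e cphi.
- by rewrite /= in_itv/= lexx ltW.
- by [].
pose u := a + Num.min (d / 2) ((b - a) / 2).
have m0 : 0 < Num.min (d / 2) ((b - a) / 2) by rewrite lt_min; apply/andP; split; lra.
have m1 : Num.min (d / 2) ((b - a) / 2) <= d / 2 by rewrite ge_min lexx.
have m2 : Num.min (d / 2) ((b - a) / 2) <= (b - a) / 2 by rewrite ge_min lexx orbT.
have uab : a < u < b by rewrite /u; apply/andP; split; lra.
have /hd hdu : [set` `[a, b]] u by rewrite /= in_itv/= /u; apply/andP; split; lra.
have /hdu : `|u - a| < d by rewrite ltr_norml /u; apply/andP; split; lra.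
rewrite ltr_norml => /andP[].
have := in_le _ uab; lra.
Qed.

(** Both [psi - H] and [- psi - H] have a nonpositive upper right Dini derivative. *)
Lemma right_dini_norm_le a b psi H : a <= b ->
  {within `[a, b], continuous psi} -> {within `[a, b], continuous H} ->
  (forall x e, a < x < b -> 0 < e -> \forall y \near x^'+,
     `|psi y - psi x| <= H y - H x + e * (y - x)) ->
  `|psi b - psi a| <= H b - H a.
Proof.
move=> ab cpsi cH dpsi; rewrite ler_norml; apply/andP; split.
- suff : - psi b - H b <= - psi a - H a by lra.
  apply: (@right_dini_le a b (fun x => - psi x - H x)) => //.
    apply: within_continuousB => // x.
    exact: (@continuousN _ _ (subspace `[a, b]) _ _ (cpsi x)).
  move=> x e xab e0; apply: filterS (dpsi _ _ xab e0) => y.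
  by rewrite ler_norml => /andP[]; lra.
- suff : psi b - H b <= psi a - H a by lra.
  apply: (@right_dini_le a b (fun x => psi x - H x)) => //.
    exact: within_continuousB.
  move=> x e xab e0; apply: filterS (dpsi _ _ xab e0) => y.
  by rewrite ler_norml => /andP[]; lra.
Qed.

End dini.

(** * Difference quotients within an interval and differentiation rules *)

Section derivative.
Context {R : realType}.
Implicit Types (I : set R) (a b u v x y c d e l : R) (f g h phi psi H : R -> R).

(** The Caratheodory slope is the difference quotient completed by [l] at [x]; near an interior
    point the restriction to [I] is void. *)
Lemma has_derivative_within_interior I f x l : interior I x ->
  has_derivative_within I f x l -> is_derive x 1 f l.
Proof.
move=> Ix fl; apply/is_derive1_caratheodory.
exists (fun z => if z == x then l else (f z - f x) / (z - x)); split.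
- move=> z; case: eqVneq => [->|zx]; first by rewrite !subrr mulr0.
  by rewrite divfK// subr_eq0.
- apply/cvgrPdist_lt => e e0; rewrite eqxx.
  move/cvgrPdist_lt : fl => /(_ _ e0); rewrite near_withinE near_withinE => fl.
  near=> z; case: eqVneq => [_|zx]; first by rewrite subrr normr0.
  have Iz : I z by near: z; exact: Ix.
  by move: zx Iz; near: z.
- by rewrite eqxx.
Unshelve. all: by end_near. Qed.

Lemma is_derive_has_derivative_within I f x l :
  is_derive x 1 f l -> has_derivative_within I f x l.
Proof.
move=> /is_derive1_caratheodory[g [fg cg <-]].
apply/cvgrPdist_lt => e e0; rewrite near_withinE near_withinE.
move/cvgrPdist_lt : cg => /(_ _ e0); apply: filterS => z gz zx _.
by rewrite fg mulfK// subr_eq0.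
Qed.

(** Near [x] the difference quotient is at most [|g x| + 1] in absolute value, so [f] is Lipschitz
    at [x] within [I]. *)
Lemma derivative_on_continuous I f g : derivative_on I f g ->
  {within I, continuous f}.
Proof.
move=> fg; apply/subspace_continuousP => x Ix.
have /cvgrPdist_lt/(_ _ ltr01) := fg x Ix.
rewrite near_withinE near_withinE => qx.
apply/cvgrPdist_lt => e e0; rewrite near_withinE.
near=> z => Iz; have [->|zx] := eqVneq z x; first by rewrite subrr normr0.
have qz : `|g x - (f z - f x) / (z - x)| < 1 by move: zx Iz; near: z.
have zxd : `|x - z| < e / (`|g x| + 1).
  by near: z; apply: cvgr_dist_lt => //; rewrite divr_gt0// ltr_wpDl.
have zx0 : 0 < `|x - z| by rewrite normr_gt0 subr_eq0 eq_sym.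
have : `|(f z - f x) / (z - x)| < `|g x| + 1.
  rewrite -[X in `|X| < _](subKr (g x)).
  by rewrite (le_lt_trans (ler_normB _ _))// ltrD2l.
rewrite normrM normfV [`|z - x|]distrC ltr_pdivrMr// => fzx; rewrite [X in X < _]distrC.
apply: lt_le_trans fzx _.
rewrite mulrC -ler_pdivlMr ?(ltW zxd)// ltr_wpDl.
Unshelve. all: by end_near. Qed.

Lemma interior_itv_sub I a b x : is_interval I -> I a -> I b -> a < x < b ->
  interior I x.
Proof.
move=> Ii Ia Ib /andP[ax xb].
apply: (@filterS _ _ _ `]a, b[%classic).
  move=> z /=; rewrite in_itv/= => /andP[az zb].
  by apply: (Ii _ _ Ia Ib); rewrite (ltW az) (ltW zb).
by apply: near_in_itvoo; rewrite in_itv/= ax.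
Qed.

Lemma is_derive_continuous f x a : is_derive x 1 f a -> {for x, continuous f}.
Proof. by move=> [fx _]; apply/differentiable_continuous/derivable1_diffP. Qed.

(** These rules are restated for explicit functions, so that derivatives of compound formulas can be
    assembled as terms. *)
Lemma is_derive1D f g x a b : is_derive x 1 f a -> is_derive x 1 g b ->
  is_derive x 1 (fun y => f y + g y) (a + b).
Proof. exact: is_deriveD. Qed.

Lemma is_derive1B f g x a b : is_derive x 1 f a -> is_derive x 1 g b ->
  is_derive x 1 (fun y => f y - g y) (a - b).
Proof. exact: is_deriveB. Qed.

Lemma is_derive1M f g x a b : is_derive x 1 f a -> is_derive x 1 g b ->
  is_derive x 1 (fun y => f y * g y) (f x * b + g x * a).
Proof. exact: is_deriveM. Qed.

Lemma is_derive1cM c f x a : is_derive x 1 f a ->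
  is_derive x 1 (fun y => c * f y) (c * a).
Proof. exact: is_deriveZ. Qed.

Lemma is_derive1X f n x a : is_derive x 1 f a ->
  is_derive x 1 (fun y => f y ^+ n) (n%:R * f x ^+ n.-1 * a).
Proof. by move=> fa; rewrite -exprfctE; exact: is_deriveX. Qed.

Lemma is_derive1_subc c x : is_derive x 1 (fun y => y - c) 1.
Proof. by rewrite -[X in is_derive _ _ _ X]subr0; apply: is_derive1B. Qed.

Lemma is_derive1_increment f x a c : is_derive x 1 f a -> 0 < c ->
  \forall y \near x, `|f y - f x - a * (y - x)| <= c * `|y - x|.
Proof.
move=> /is_derive1_caratheodory[g [fg cg <-]] c0.
move/cvgrPdist_lt : cg => /(_ _ c0); apply: filterS => y gy.
by rewrite fg -mulrBl normrM ler_wpM2r// distrC ltW.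
Qed.

End derivative.

(** * The boundary form *)

Section boundary_form.
Context {R : realType}.
Local Notation mu := (@lebesgue_measure R).
Implicit Types (x y z c d e l : R).

Lemma absolutely_continuous_onS (A B : set R) (F : R -> R) : A `<=` B ->
  absolutely_continuous_on B F -> absolutely_continuous_on A F.
Proof.
move=> AB acF e e0; have [d d0 hd] := acF e e0; exists d => // n u v uv uvA.
by apply: hd => // i; exact: subset_trans (uvA i) AB.
Qed.

Lemma absolutely_continuous_on_uniform (A : set R) (F : R -> R) e :
  is_interval A -> absolutely_continuous_on A F -> 0 < e ->
  exists2 d, 0 < d & forall x y, A x -> A y -> `|y - x| < d -> `|F y - F x| < e.
Proof.
move=> iA acF e0; have [d d0 hd] := acF e e0; exists d => // x y Ax Ay.
wlog xy : x y Ax Ay / x <= y.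
  move=> wl xyd; have [xy|/ltW yx] := leP x y; first exact: wl.
  by rewrite distrC; apply: wl => //; rewrite distrC.
move=> xyd; have := hd 1%N (fun=> x) (fun=> y).
rewrite !big_ord1; apply => //.
- by move=> _ z /=; rewrite in_itv/=; exact: iA.
- by move=> i j _ _ _; rewrite !ord1.
- by rewrite (le_lt_trans (ler_norm _)).
Qed.

Variables (f f1 f2 : R -> R) (a b : R).
Hypothesis ab : a < b.
Hypotheses (cf : {within `[a, b], continuous f})
  (cf1 : {within `[a, b], continuous f1})
  (acf2 : absolutely_continuous_on `]a, b[ f2)
  (df : forall x, a < x < b -> is_derive x 1 f (f1 x))
  (df1 : forall x, a < x < b -> is_derive x 1 f1 (f2 x)).

Definition midpoint := (a + b) / 2.
Definition radius := (b - a) / 2.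
Local Notation m := midpoint.
Local Notation r := radius.

Definition peano_kernel x := 6^-1 * ((x - m) ^+ 3 - r ^+ 2 * (x - m)).
Definition dpeano_kernel x := 6^-1 * (3 * (x - m) ^+ 2 - r ^+ 2).
Definition primitive x := \int[mu]_(t in `[a, x]) f t.
(* Formally an antiderivative of peano_kernel * f'''. *)
Definition boundary_form x :=
  peano_kernel x * f2 x - dpeano_kernel x * f1 x + (x - m) * f x - primitive x.

Let f_int : mu.-integrable `[a, b] (EFin \o f).
Proof. by apply: continuous_compact_integrable => //; exact: segment_compact. Qed.

(** The kernel vanishes at [a] and [b], which removes [f2]; its derivative equals
    [(b - a) ^+ 2 / 12] at both. *)
Lemma boundary_formB : boundary_form b - boundary_form a =
  (b - a) * ((f a + f b) / 2 - (b - a)^-1 * \int[mu]_(x in `[a, b]) f x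
     - (b - a) / 12 * (f1 b - f1 a)).
Proof.
have ba0 : b - a != 0 by rewrite subr_eq0 gt_eqF.
have Pa : primitive a = 0 by rewrite /primitive set_itv1 Rintegral_set1.
rewrite /boundary_form Pa /peano_kernel /dpeano_kernel /m /r /primitive.
by field.
Qed.

Lemma is_derive_peano_kernel x : is_derive x 1 peano_kernel (dpeano_kernel x).
Proof.
have dm := is_derive1_subc m x.
have := is_derive1cM 6^-1 (is_derive1B (is_derive1X 3 dm) (is_derive1cM (r ^+ 2) dm)).
by move=> /is_derive_eq; apply; rewrite /dpeano_kernel /=; field.
Qed.

Lemma is_derive_dpeano_kernel x : is_derive x 1 dpeano_kernel (x - m).
Proof.
have dm := is_derive1_subc m x.
have := is_derive1cM 6^-1
  (is_derive1B (is_derive1cM 3 (is_derive1X 2 dm)) (is_derive_cst (r ^+ 2) x 1)).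
by move=> /is_derive_eq; apply; rewrite /=; field.
Qed.

Lemma peano_kernel_left : peano_kernel a = 0.
Proof. by rewrite /peano_kernel /m /r; field. Qed.

Lemma peano_kernel_right : peano_kernel b = 0.
Proof. by rewrite /peano_kernel /m /r; field. Qed.

Let f2_uniform e : 0 < e -> exists2 d, 0 < d & forall x y, a < x < b -> a < y < b ->
  `|y - x| < d -> `|f2 y - f2 x| < e.
Proof.
move=> e0; have [|d d0 hd] := absolutely_continuous_on_uniform _ acf2 e0.
  exact: interval_is_interval.
by exists d => // x y xab yab; apply: hd; rewrite /= in_itv.
Qed.

(** [z] may be an endpoint, where nothing is known of [f2]. Uniform continuity still bounds [f2] on
    the points of the open interval near [z], and the kernel tends to 0. *)
Let peano_kernel_f2_cvg (F : set_system R) z : Filter F -> F --> z -> peano_kernel z = 0 ->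
  (\forall x \near F, a < x < b) -> peano_kernel x * f2 x @[x --> F] --> 0.
Proof.
move=> FF Fz kz Fab.
have [d d0 hd] := f2_uniform ltr01.
have zd : \forall x \near F, `|z - x| < d / 2 by apply: cvgr_dist_lt => //; lra.
have ck : peano_kernel x @[x --> F] --> 0.
  by rewrite -kz; apply: cvg_comp Fz (is_derive_continuous (is_derive_peano_kernel z)).
(* [w] is a reference point for bounding [f2]; if there is none, the filter is eventually empty and
   the limit is trivial. *)
have [[w [wab zw]]|noF] := pselect (exists w, a < w < b /\ `|z - w| < d / 2); last first.
  apply/cvgrPdist_lt => e e0; near=> x; exfalso; apply: noF; exists x.
  by split; near: x.
apply/cvgrPdist_lt => e e0.
have M0 : 0 < `|f2 w| + 1 by rewrite ltr_wpDl.
have eM : 0 < e / (`|f2 w| + 1) by rewrite divr_gt0.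
near=> x.
have xab : a < x < b by near: x.
have zx : `|z - x| < d / 2 by near: x.
have kx : `|0 - peano_kernel x| < e / (`|f2 w| + 1).
  by near: x; move/cvgrPdist_lt : ck; exact.
have fx : `|f2 x| < `|f2 w| + 1.
  have /(hd _ _ wab xab) fd : `|x - w| < d.
    rewrite (_ : x - w = (z - w) - (z - x)); last by ring.
    by rewrite (le_lt_trans (ler_normB _ _))//; lra.
  rewrite (_ : f2 x = f2 w + (f2 x - f2 w)); last by ring.
  by rewrite (le_lt_trans (ler_normD _ _))// ltrD2l.
rewrite sub0r normrN in kx; rewrite sub0r normrN normrM.
have [->|k0] := eqVneq (peano_kernel x) 0; first by rewrite normr0 mul0r.
have : `|peano_kernel x| * `|f2 x| < `|peano_kernel x| * (`|f2 w| + 1).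
  by rewrite ltr_pM2l// normr_gt0.
move=> /lt_trans; apply.
by rewrite -ltr_pdivlMr.
Unshelve. all: by end_near. Qed.

(** Only [peano_kernel * f2] is delicate, at the endpoints, where it tends to its value 0. *)
Lemma continuous_boundary_form : {within `[a, b], continuous boundary_form}.
Proof.
have poly_cont (g g' : R -> R) : (forall x, is_derive x 1 g (g' x)) ->
    {within `[a, b], continuous g}.
  by move=> gg'; apply: continuous_subspaceT => x; exact: is_derive_continuous (gg' x).
apply: within_continuousB; last first.
  exact: parameterized_integral_continuous (ltW ab) f_int.
apply: within_continuousD; last first.
  apply: within_continuousM => //.
  exact: poly_cont (fun x => is_derive1_subc m x).
apply: within_continuousB; last first.
  apply: within_continuousM => //; exact: poly_cont is_derive_dpeano_kernel.
apply/(continuous_within_itvP _ ab); split.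
- move=> x; rewrite in_itv/= => xab; apply: continuousM.
    exact: is_derive_continuous (is_derive_peano_kernel x).
  apply/cvgrPdist_lt => e /f2_uniform[d d0 hd].
  near=> y; have yab : y \in `]a, b[.
    by near: y; apply: near_in_itvoo; rewrite in_itv.
  have xyd : `|x - y| < d by near: y; exact: cvgr_dist_lt.
  by rewrite distrC; apply: hd; rewrite // distrC.
- rewrite peano_kernel_left mul0r; apply: (@peano_kernel_f2_cvg _ a) => //.
  + exact: cvg_within.
  + exact: peano_kernel_left.
  + near=> x; apply/andP; split; near: x; [exact: nbhs_right_gt|exact: nbhs_right_lt].
- rewrite peano_kernel_right mul0r; apply: (@peano_kernel_f2_cvg _ b) => //.
  + exact: cvg_within.
  + exact: peano_kernel_right.
  + near=> x; apply/andP; split; near: x; [exact: nbhs_left_gt|exact: nbhs_left_lt].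
Unshelve. all: by end_near. Qed.

Let is_derive_primitive x : a < x < b -> is_derive x 1 primitive (f x).
Proof.
move=> xab; have /andP[ax xb] := xab.
have [|dP PE] := @continuous_FTC1_closed _ f a x b xb f_int ax.
  exact: is_derive_continuous (df xab).
by apply: (DeriveDef dP); rewrite -derive1E; exact: PE.
Qed.

(** With the factor [f2] frozen at [x], the form has derivative 0 at [x]. This stands in for the
    formal derivative [peano_kernel * f'''] at points where [f2] may fail to be differentiable. *)
Let boundary_form_increment x e : a < x < b -> 0 < e -> \forall y \near x,
  `|boundary_form y - boundary_form x| <= `|peano_kernel y| * `|f2 y - f2 x| + e * `|y - x|.
Proof.
move=> xab e0.
have dB := is_derive1B (is_derive1D (is_derive1B
  (is_derive1cM (f2 x) (is_derive_peano_kernel x))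
  (is_derive1M (is_derive_dpeano_kernel x) (df1 xab)))
  (is_derive1M (is_derive1_subc m x) (df xab))) (is_derive_primitive xab).
apply: filterS (is_derive1_increment dB e0) => y.
set D := (X in X * (y - x)); have -> : D = 0 by rewrite /D; ring.
rewrite mul0r subr0 => dBy.
rewrite (_ : boundary_form y - boundary_form x = peano_kernel y * (f2 y - f2 x) +
  (f2 x * peano_kernel y - dpeano_kernel y * f1 y + (y - m) * f y - primitive y -
  (f2 x * peano_kernel x - dpeano_kernel x * f1 x + (x - m) * f x - primitive x))); last first.
  by rewrite /boundary_form; ring.
by rewrite (le_trans (ler_normD _ _))// normrM lerD2l.
Qed.

(** The constant [c], which may depend on [e], replaces [|f'''(x)|] in the mean value inequality. *)
Lemma boundary_form_increment_le (H H' : R -> R) u v : a <= u -> u <= v -> v <= b ->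
  {within `[u, v], continuous H} ->
  (forall x, u < x < v -> is_derive x 1 H (H' x)) ->
  (forall x e, u < x < v -> 0 < e -> exists c, [/\ 0 <= c,
     `|peano_kernel x| * c <= H' x + e &
     \forall y \near x^'+, `|f2 y - f2 x| <= c * (y - x)]) ->
  `|boundary_form v - boundary_form u| <= H v - H u.
Proof.
move=> au uv vb cH dH Hk; apply: right_dini_norm_le => //.
  apply: continuous_subspaceW continuous_boundary_form.
  by apply: subset_itvScc; rewrite bnd_simp.
(* The four quarters of [e] pay for the slack in [Hk], the change of the kernel between [x] and [y],
   and the remainders in the increments of [boundary_form] and [H]. *)
move=> x e xuv e0; have e40 : 0 < e / 4 by rewrite divr_gt0.
have xab : a < x < b by lra.
have [c [c0 kc f2c]] := Hk _ _ xuv e40.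
(* The denominator [c + 1] accommodates [c = 0]. *)
have c10 : 0 < e / 4 / (c + 1) by rewrite divr_gt0// ltr_wpDl.
near=> y.
have xy : x < y by near: y; exact: nbhs_right_gt.
have yx0 : 0 < y - x by rewrite subr_gt0.
have yxE : `|y - x| = y - x by rewrite gtr0_norm.
have aux_y : `|boundary_form y - boundary_form x| <=
    `|peano_kernel y| * `|f2 y - f2 x| + e / 4 * `|y - x|.
  by near: y; apply: cvg_within; exact: boundary_form_increment.
have H_y : `|H y - H x - H' x * (y - x)| <= e / 4 * `|y - x|.
  by near: y; apply: cvg_within; exact: is_derive1_increment (dH _ xuv) e40.
have k_y : `|peano_kernel x - peano_kernel y| < e / 4 / (c + 1).
  near: y; apply: cvg_within.
  by move/cvgrPdist_lt : (is_derive_continuous (is_derive_peano_kernel x)); exact.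
have f2_y : `|f2 y - f2 x| <= c * (y - x) by near: y.
have kyc : `|peano_kernel y| * c <= `|peano_kernel x| * c + e / 4.
  have : `|peano_kernel y| <= `|peano_kernel x| + e / 4 / (c + 1).
    rewrite (_ : peano_kernel y = peano_kernel x - (peano_kernel x - peano_kernel y)); last first.
      by ring.
    by rewrite (le_trans (ler_normB _ _))// lerD2l ltW.
  move=> /(ler_wpM2r c0) /le_trans; apply.
  rewrite mulrDl lerD2l mulrAC ler_pdivrMr ?ltr_wpDl//.
  by rewrite ler_pM2l//; lra.
have : `|peano_kernel y| * `|f2 y - f2 x| <= (H' x + e / 4 + e / 4) * (y - x).
  apply: (@le_trans _ _ (`|peano_kernel y| * (c * (y - x)))).
    by rewrite ler_wpM2l.
  by rewrite mulrA ler_wpM2r ?(ltW yx0)//; lra.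
rewrite yxE in aux_y H_y; move: H_y; rewrite ler_norml => /andP[H_y _].
have := mulr_gt0 e0 yx0; lra.
Unshelve. all: by end_near. Qed.

End boundary_form.

(** * The comparison function *)

Section comparison.
Context {R : realType}.

Lemma continuous_norm_powR (t : R) : 0 < t -> continuous (fun x : R => `|x| `^ t).
Proof.
move=> t0 x; have [->|x0] := eqVneq x 0.
  rewrite /continuous_at normr0 powR0 ?gt_eqF//.
  apply/cvgrPdist_lt => e e0.
  have et0 : 0 < e `^ t^-1 by rewrite powR_gt0.
  near=> y; rewrite sub0r normrN ger0_norm ?powR_ge0//.
  have ye : `|0 - y| < e `^ t^-1 by near: y; exact: cvgr_dist_lt.
  rewrite sub0r normrN in ye.
  rewrite (_ : e = (e `^ t^-1) `^ t); last by rewrite -powRrM mulVf ?gt_eqF// powRr1// ltW.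
  by rewrite gt0_ltr_powR// nnegrE// ltW.
apply: (@continuous_comp _ _ _ (fun x : R => `|x|) (fun y => y `^ t)).
  exact: norm_continuous.
have x_gt0 : 0 < `|x| by rewrite normr_gt0.
exact: is_derive_continuous (is_derive1_powR t x_gt0).
Unshelve. all: by end_near. Qed.

Variables (f2 f3 : R -> R) (a b p q alpha beta A B : R).
Hypotheses (ab : a < b) (p0 : 0 < p) (q0 : 0 < q) (alpha0 : 0 < alpha) (beta0 : 0 < beta)
  (A0 : 0 <= A) (B0 : 0 <= B)
  (young : forall s c, 0 <= s -> 0 <= c -> s * c <= alpha * s `^ p + beta * c `^ q).
Local Notation m := (midpoint a b).
Local Notation r := (radius a b).

(* The Godunova-Levin bound at x = t a + (1 - t) b, with t = (b - x) / (b - a). *)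
Definition majorant x := (b - a) * (A / (b - x) + B / (x - a)).

(* An antiderivative of dcomparison on the half of [a, b] where sgn = 1 or -1 is
   the sign of x - m; the absolute values make it continuous at m as well. *)
Definition comparison (sgn x : R) := r / 6 *
  (alpha * r ^+ 3 * sgn * (`|(x - m) / r| `^ (p + 1) / (p + 1)
                           - `|(x - m) / r| `^ (p + 3) / (p + 3))
   + beta * r * (A * (x - a) ^+ 2 - B * (b - x) ^+ 2)).

(** [|peano_kernel|] is [r / 6 * ((x - a) * (b - x))] times [|(x - m) / r|]. Young's inequality is
    applied to this last factor only; the remaining weight cancels the poles of [majorant]. *)
Definition dcomparison x := r / 6 * ((x - a) * (b - x)) *
  (alpha * `|(x - m) / r| `^ p + beta * majorant x).

Let r0 : 0 < r.
Proof. by rewrite divr_gt0 ?subr_gt0. Qed.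

Lemma continuous_comparison sgn : continuous (comparison sgn).
Proof.
have cz : continuous (fun x => (x - m) / r).
  by move=> x; apply: cvgMl; apply: cvgB; [exact: cvg_id|exact: cvg_cst].
have cpow t : 0 < t -> continuous (fun x => `|(x - m) / r| `^ t / t).
  move=> t0 x; apply: cvgMl.
  apply: (@continuous_comp _ _ _ (fun x => (x - m) / r) (fun x : R => `|x| `^ t)).
    exact: cz.
  exact: continuous_norm_powR.
move=> x; apply: cvgMr; apply: cvgD.
  by apply: cvgMr; apply: cvgB; apply: cpow; rewrite addr_gt0.
apply: cvgMr.
have := is_derive1B (is_derive1cM A (is_derive1X 2 (is_derive1_subc a x)))
  (is_derive1cM B (is_derive1X 2 (is_derive1B (is_derive_cst b x 1) (is_derive_id x 1)))).
exact: is_derive_continuous.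
Qed.

(** On the chosen half, [|x - m| = sgn * (x - m)]. The identity [(x - a) * (b - x) = r ^+ 2 - (x -
    m) ^+ 2] produces the exponents [p + 1] and [p + 3]. *)
Lemma is_derive_comparison sgn x : sgn * sgn = 1 -> a < x < b -> 0 < sgn * (x - m) ->
  is_derive x 1 (comparison sgn) (dcomparison x).
Proof.
move=> sgn2 xab xm.
have sz : 0 < sgn / r * (x - m) by rewrite mulrAC divr_gt0.
have dz := is_derive1cM (sgn / r) (is_derive1_subc m x).
have dpow t : is_derive x 1 (fun y => (sgn / r * (y - m)) `^ t)
    (t * (sgn / r * (x - m)) `^ (t - 1) * (sgn / r * 1)).
  exact: (@is_derive1_comp _ (fun y => y `^ t) (fun y => sgn / r * (y - m)) _ _ _
    (is_derive1_powR t sz) dz).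
have := is_derive1cM (r / 6) (is_derive1D
  (is_derive1cM (alpha * r ^+ 3 * sgn) (is_derive1B
    (is_derive1cM (p + 1)^-1 (dpow (p + 1))) (is_derive1cM (p + 3)^-1 (dpow (p + 3)))))
  (is_derive1cM (beta * r) (is_derive1B
    (is_derive1cM A (is_derive1X 2 (is_derive1_subc a x)))
    (is_derive1cM B (is_derive1X 2 (is_derive1B (is_derive_cst b x 1) (is_derive_id x 1))))))).
move=> dH.
have zE y : 0 < sgn * (y - m) -> `|(y - m) / r| = sgn / r * (y - m).
  move=> ym; rewrite -[LHS]mul1r.
  have -> : 1 = `|sgn|.
    have : `|sgn| ^+ 2 = 1 by rewrite -normrX expr2 sgn2 normr1.
    by move/eqP; rewrite sqrf_eq1 => /orP[/eqP->//|/eqP h]; have := normr_ge0 sgn; lra.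
  by rewrite -normrM mulrA ger0_norm; [rewrite mulrAC|rewrite ltW// divr_gt0].
have nearE : \forall y \near x, r / 6 *
  (alpha * r ^+ 3 * sgn * ((p + 1)^-1 * (sgn / r * (y - m)) `^ (p + 1)
                           - (p + 3)^-1 * (sgn / r * (y - m)) `^ (p + 3))
   + beta * r * (A * (y - a) ^+ 2 - B * (b - y) ^+ 2)) = comparison sgn y.
  have csm : sgn * (y - m) @[y --> x] --> sgn * (x - m).
    by apply: cvgMr; apply: cvgB; [exact: cvg_id|exact: cvg_cst].
  near=> y; have ym : 0 < sgn * (y - m) by near: y; exact: (cvgr_gt _ csm).
  by rewrite /comparison zE// ![_ `^ _ / _]mulrC.
apply: (near_eq_is_derive nearE); apply: is_derive_eq dH _.
rewrite /dcomparison zE// /majorant.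
have -> : p + 1 - 1 = p by ring.
have -> : p + 3 - 1 = p + 2%:R by ring.
rewrite powRD; last by rewrite (gt_eqF sz) implybT.
rewrite powR_mulrn ?ltW//.
set w := (_ `^ p).
have ra : r = (b - a) / 2 by [].
have xa0 : x - a != 0 by rewrite gt_eqF//; lra.
have bx0 : b - x != 0 by rewrite gt_eqF//; lra.
have rn0 : r != 0 by rewrite gt_eqF.
have p10 : p + 1 != 0 by rewrite gt_eqF// addr_gt0.
have p30 : p + 3 != 0 by rewrite gt_eqF// addr_gt0.
(* The products [sgn * sgn] are isolated so that they can be replaced by 1 before the final
   identity. *)
transitivity (r / 6 * (alpha * w * (sgn * sgn) * (r ^+ 2 - sgn * sgn * (x - m) ^+ 2)
    + beta * r * 2 * (A * (x - a) + B * (b - x)))).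
  by rewrite /= /cst; field; apply/and3P.
rewrite sgn2 ra /midpoint; field.
by apply/andP.
Unshelve. all: by end_near. Qed.

Hypotheses (ac_f2 : absolutely_continuous_on `]a, b[ f2)
  (f3_def : forall x l, a < x < b -> is_derive x 1 f2 l -> f3 x = l)
  (f3_le : forall x, a < x < b -> `|f3 x| `^ q <= majorant x).

Let majorant_continuous x : a < x < b -> {for x, continuous majorant}.
Proof.
move=> /andP[ax xb]; apply: cvgMr; apply: cvgD.
  apply: cvgMr; apply: cvgV; first by rewrite subr_eq0 gt_eqF.
  by apply: cvgB; [exact: cvg_cst|exact: cvg_id].
apply: cvgMr; apply: cvgV; first by rewrite subr_eq0 gt_eqF.
by apply: cvgB; [exact: cvg_id|exact: cvg_cst].
Qed.

(** By continuity [majorant] stays below [majorant x + e] near [x], which bounds the derivative of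
    [f2] there wherever it exists; absolute continuity turns this into a Lipschitz bound. *)
Let f2_lipschitz_near x e : a < x < b -> 0 < e -> \forall y \near x^'+,
  `|f2 y - f2 x| <= (majorant x + e) `^ q^-1 * (y - x).
Proof.
move=> xab e0; have /cvgrPdist_lt/(_ _ e0) := majorant_continuous xab.
move=> /nbhs_ballP[d /= d0 hd]; have /andP[ax xb] := xab.
have M0 : 0 <= majorant x.
  by rewrite (le_trans _ (f3_le xab))// powR_ge0.
near=> y.
have xy : x < y by near: y; exact: nbhs_right_gt.
have yb : y < b by near: y; exact: nbhs_right_lt.
have yd : y < x + d by near: y; apply: nbhs_right_lt; rewrite ltrDl.
apply: ac_itv_derive_bound; rewrite ?powR_ge0 ?(ltW xy)//.
  apply: absolutely_continuous_on_itv ac_f2 => z /=.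
  by rewrite !in_itv/=; lra.
move=> z l /andP[xz zy] dl; have zab : a < z < b by lra.
rewrite -(f3_def zab dl).
have qn0 : q != 0 by rewrite gt_eqF.
rewrite -[leLHS]powRr1// -(mulfV qn0) powRrM.
apply: ge0_ler_powR; rewrite ?invr_ge0 ?(ltW q0) ?nnegrE ?powR_ge0//.
  by rewrite addr_ge0// ltW.
apply: le_trans (f3_le zab) _.
have xzd : ball x d z by rewrite /ball/= ltr_norml; apply/andP; split; lra.
by have := hd z xzd; rewrite /= ltr_norml => /andP[]; lra.
Unshelve. all: by end_near. Qed.

Lemma peano_kernel_dcomparison x e : a < x < b -> 0 < e -> exists c, [/\ 0 <= c,
  `|peano_kernel a b x| * c <= dcomparison x + e &
  \forall y \near x^'+, `|f2 y - f2 x| <= c * (y - x)].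
Proof.
move=> xab e0; have /andP[ax xb] := xab.
pose w := r / 6 * ((x - a) * (b - x)).
have w0 : 0 < w by rewrite !mulr_gt0 ?subr_gt0 ?invr_gt0.
(* Chosen so that the excess [w * beta * e1] after Young's inequality is exactly [e]. *)
pose e1 := e / (w * beta).
have e10 : 0 < e1 by rewrite divr_gt0// mulr_gt0.
exists ((majorant x + e1) `^ q^-1); split.
- by rewrite powR_ge0.
- set c := _ `^ _.
  have cq : c `^ q = majorant x + e1.
    rewrite /c -powRrM mulVf ?gt_eqF// powRr1// addr_ge0 ?(ltW e10)//.
    by rewrite (le_trans _ (f3_le xab))// powR_ge0.
  have -> : `|peano_kernel a b x| = w * `|(x - m) / r|.
    rewrite -[w in RHS]gtr0_norm// -normrM -[LHS]normrN; congr `| _ |.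
    rewrite /w /peano_kernel /midpoint /radius; field.
    by rewrite subr_eq0 gt_eqF.
  rewrite -mulrA; apply: le_trans.
    apply: ler_wpM2l (ltW w0) _ _ (young (normr_ge0 _) _).
    exact: powR_ge0.
  rewrite cq /dcomparison -/w le_eqVlt; apply/orP; left; apply/eqP.
  rewrite /e1; field.
  by rewrite !gt_eqF.
- exact: f2_lipschitz_near.
Qed.

(** At [m] the powers vanish and the quadratic terms cancel. At the endpoints the powers are 1, and
    [1 / (p + 1) - 1 / (p + 3) = 2 / ((p + 1) * (p + 3))]. *)
Lemma comparison_total :
  (comparison 1 b - comparison 1 m) + (comparison (-1) m - comparison (-1) a) =
  2 / 3 * r ^+ 4 * (alpha / ((p + 1) * (p + 3)) + beta * (A + B)).
Proof.
have p10 : p + 1 != 0 by rewrite gt_eqF// addr_gt0.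
have p30 : p + 3 != 0 by rewrite gt_eqF// addr_gt0.
have mE : midpoint a b - midpoint a b = 0 by rewrite subrr.
have bE : `|(b - m) / r| = 1.
  rewrite (_ : b - m = r); first by rewrite divff ?normr1// gt_eqF.
  by rewrite /midpoint /radius; field.
have aE : `|(a - m) / r| = 1.
  rewrite (_ : a - m = - r); first by rewrite mulNr divff ?normrN1// gt_eqF.
  by rewrite /midpoint /radius; field.
rewrite /comparison mE mul0r normr0 bE aE !powR1 !powR0//.
rewrite /midpoint /radius; field.
by apply/andP.
Qed.

End comparison.

(** * Young's inequality with weights and their optimisation *)

Section weighted_young.
Context {R : realType}.
Implicit Types (p q s c mu X Y E : R).

(** Young's inequality applied to [mu * s] and [mu^-1 * c]. *)
Lemma weighted_young p q mu s c : 0 < p -> 0 < q -> p^-1 + q^-1 = 1 -> 0 < mu ->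
  0 <= s -> 0 <= c -> s * c <= mu `^ p / p * s `^ p + mu^-1 `^ q / q * c `^ q.
Proof.
move=> p0 q0 pq mu0 s0 c0.
have -> : s * c = (mu * s) * (mu^-1 * c) by field; rewrite gt_eqF.
have mu_ge0 := ltW mu0.
have mus0 : 0 <= mu * s by rewrite mulr_ge0.
have muc0 : 0 <= mu^-1 * c by rewrite mulr_ge0 ?invr_ge0.
apply: le_trans (conjugate_powR mus0 muc0 p0 q0 pq) _.
rewrite !powRM ?invr_ge0//.
by rewrite (mulrAC _ (s `^ p)) (mulrAC _ (c `^ q)).
Qed.

(** Minimising the weighted sums over [mu] gives the product form of Hoelder's inequality. For
    [Y = 0] the infimum is not attained and is approached as [mu] tends to 0. *)
Lemma le_optimal_weight p q X Y E : 0 < p -> 0 < q -> p^-1 + q^-1 = 1 ->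
  0 < X -> 0 <= Y ->
  (forall mu, 0 < mu -> E <= mu `^ p / p * X + mu^-1 `^ q / q * Y) ->
  E <= X `^ p^-1 * Y `^ q^-1.
Proof.
move=> p0 q0 pq X0; rewrite le_eqVlt => /predU1P[<- EX|Y0 EXY].
  rewrite powR0 ?invr_eq0 ?gt_eqF// mulr0; apply/ler_addgt0Pr => e e0.
  (* The weight with [mu ^ p = e * p / X] makes the remaining term equal to [e]. *)
  have e1 : 0 < e * p / X by rewrite divr_gt0// mulr_gt0.
  have := EX _ (powR_gt0 p^-1 e1).
  rewrite -powRrM mulVf ?gt_eqF// powRr1 ?(ltW e1)// mulr0 addr0 add0r.
  move/le_trans; apply; rewrite le_eqVlt; apply/orP; left; apply/eqP; field.
  by rewrite !gt_eqF.
pose w := Y / X.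
have w0 : 0 < w by rewrite divr_gt0.
have wX s : w `^ s * X `^ s = Y `^ s.
  by rewrite -powRM ?ltW// /w divfK// gt_eqF.
have XE : X = X `^ p^-1 * X `^ q^-1.
  by rewrite -powRD ?pq ?powRr1 ?ltW// (gt_eqF X0) implybT.
have YE : Y = Y `^ p^-1 * Y `^ q^-1.
  by rewrite -powRD ?pq ?powRr1 ?ltW// (gt_eqF Y0) implybT.
(* The minimiser, for which both terms are proportional to X^(1/p) Y^(1/q). *)
pose mu := w `^ (p * q)^-1.
have mup : mu `^ p = w `^ q^-1.
  by rewrite /mu -powRrM; congr (_ `^ _); field; rewrite !gt_eqF.
have muq : mu^-1 `^ q = (w `^ p^-1)^-1.
  by rewrite /mu -powRN -powRrM -powRN; congr (_ `^ _); field; rewrite !gt_eqF.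
have := EXY mu (powR_gt0 _ w0); rewrite mup muq.
have -> : w `^ q^-1 / p * X = p^-1 * (X `^ p^-1 * Y `^ q^-1).
  by rewrite {1}XE -(wX q^-1); ring.
have -> : (w `^ p^-1)^-1 / q * Y = q^-1 * (X `^ p^-1 * Y `^ q^-1).
  rewrite {1}YE -(wX p^-1); field.
  by rewrite !gt_eqF// powR_gt0.
by rewrite -mulrDl pq mul1r.
Qed.

End weighted_young.

(** * Bound on the boundary form and the final inequality *)

Lemma boundary_form_le (R : realType) (f f1 f2 f3 : R -> R) (a b p q alpha beta A B : R) :
  a < b -> 0 < p -> 0 < q -> 0 < alpha -> 0 < beta ->
  (forall s c, 0 <= s -> 0 <= c -> s * c <= alpha * s `^ p + beta * c `^ q) ->
  {within `[a, b], continuous f} -> {within `[a, b], continuous f1} ->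
  absolutely_continuous_on `]a, b[ f2 ->
  (forall x, a < x < b -> is_derive x 1 f (f1 x)) ->
  (forall x, a < x < b -> is_derive x 1 f1 (f2 x)) ->
  (forall x l, a < x < b -> is_derive x 1 f2 l -> f3 x = l) ->
  (forall x, a < x < b -> `|f3 x| `^ q <= majorant a b A B x) ->
  `|boundary_form f f1 f2 a b b - boundary_form f f1 f2 a b a| <=
  2 / 3 * radius a b ^+ 4 * (alpha / ((p + 1) * (p + 3)) + beta * (A + B)).
Proof.
move=> ab p0 q0 alpha0 beta0 young cf cf1 acf2 df df1 f3E f3q.
rewrite -(comparison_total alpha beta A B ab p0).
set m := midpoint a b.
have am : a < m by rewrite /m /midpoint; lra.
have mb : m < b by rewrite /m /midpoint; lra.
have k_le x e : a < x < b -> 0 < e -> exists c, [/\ 0 <= c,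
    `|peano_kernel a b x| * c <= dcomparison a b p alpha beta A B x + e &
    \forall y \near x^'+, `|f2 y - f2 x| <= c * (y - x)].
  exact: peano_kernel_dcomparison young acf2 f3E f3q x e.
(* [comparison sgn] is an antiderivative only on the half where [sgn] is the sign of [x - m], hence
   the split at [m]. *)
have increment_le sgn u v : sgn * sgn = 1 -> a <= u -> u <= v -> v <= b ->
    (forall x, u < x < v -> 0 < sgn * (x - m)) ->
    `|boundary_form f f1 f2 a b v - boundary_form f f1 f2 a b u| <=
    comparison a b p alpha beta A B sgn v - comparison a b p alpha beta A B sgn u.
  move=> sgn2 au uv vb sgnm.
  have uvab x : u < x < v -> a < x < b by lra.
  apply: (boundary_form_increment_le ab cf cf1 acf2 df df1
    (H' := dcomparison a b p alpha beta A B) au uv vb).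
  - by apply: continuous_subspaceT; exact: continuous_comparison.
  - move=> x uxv.
    by apply: is_derive_comparison; [|by []| |exact: uvab|exact: sgnm].
  - by move=> x e uxv; apply: k_le; exact: uvab.
have left : `|boundary_form f f1 f2 a b m - boundary_form f f1 f2 a b a| <=
    comparison a b p alpha beta A B (-1) m - comparison a b p alpha beta A B (-1) a.
  by apply: increment_le => [||||x]; rewrite ?mulrNN ?mulr1 ?(ltW am) ?(ltW mb)//; lra.
have right : `|boundary_form f f1 f2 a b b - boundary_form f f1 f2 a b m| <=
    comparison a b p alpha beta A B 1 b - comparison a b p alpha beta A B 1 m.
  by apply: increment_le => [||||x]; rewrite ?mulr1 ?(ltW am) ?(ltW mb)//; lra.
rewrite (_ : _ - _ = (boundary_form f f1 f2 a b b - boundary_form f f1 f2 a b m) +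
  (boundary_form f f1 f2 a b m - boundary_form f f1 f2 a b a)); last by ring.
by rewrite (le_trans (ler_normD _ _))// lerD.
Qed.

Theorem theorem5 (R : realType) (I : set R) (f f1 f2 f3 : R -> R)
    (a b p q : R)
    (I_interval : is_interval I)
    (f1_def : derivative_on I f f1)
    (f2_def : derivative_on I f1 f2)
    (f2_ac : absolutely_continuous_on (interior I) f2)
    (f3_def : derivative_where_exists I f2 f3)
    (Ia : I a) (Ib : I b) (a_lt_b : a < b)
    (f3_L1 : (@lebesgue_measure R).-integrable `[a, b] (fun x => (f3 x)%:E))
    (q_gt1 : 1 < q) (pq : 1 / p + 1 / q = 1)
    (f3_Q : godunova_levin I (fun x => `|f3 x| `^ q)) :
  `| (f a + f b) / 2
     - 1 / (b - a) * (\int[@lebesgue_measure R]_(x in `[a, b]) f x)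
     - (b - a) / 12 * (f1 b - f1 a) |
  <= (b - a) ^+ 3 / 24
     * (1 / ((p + 1) * (p + 3))) `^ (1 / p)
     * (`|f3 a| `^ q + `|f3 b| `^ q) `^ (1 / q).
Proof.
have q0 : 0 < q by lra.
(* The sign is read off [p^-1 = 1 - q^-1]; as the inverse of 0 is 0, this also excludes [p = 0]. *)
have p0 : 0 < p.
  rewrite -invr_gt0; move: pq; rewrite !div1r => pq'.
  have : q^-1 < 1 by rewrite invf_lt1.
  by lra.
rewrite !div1r in pq *.
have I_ab : [set` `[a, b]] `<=` I.
  by move=> x /=; rewrite in_itv/=; exact: I_interval.
have int_ab x : a < x < b -> interior I x by exact: interior_itv_sub I_interval Ia Ib.
have ba0 : 0 < b - a by rewrite subr_gt0.
set D := (X in `|X|).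
(* Dividing by [(b - a) ^+ 3 / 24] leaves a product [X^(1/p) Y^(1/q)], to which the optimisation
   over weights applies. *)
suff DE : `|D| / ((b - a) ^+ 3 / 24) <=
    ((p + 1) * (p + 3))^-1 `^ p^-1 * (`|f3 a| `^ q + `|f3 b| `^ q) `^ q^-1.
  by rewrite -mulrA mulrC -ler_pdivrMr// divr_gt0// exprn_gt0.
apply: le_optimal_weight => //.
  by rewrite invr_gt0 mulr_gt0// addr_gt0.
move=> mu mu0; rewrite ler_pdivrMr ?divr_gt0 ?exprn_gt0//.
rewrite -(ler_pM2l ba0) -[X in X * `|D|]gtr0_norm// -normrM /D.
rewrite -(boundary_formB f f1 f2 a_lt_b).
apply: le_trans (@boundary_form_le R f f1 f2 f3 a b p q (mu `^ p / p) (mu^-1 `^ q / q)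
  (`|f3 a| `^ q) (`|f3 b| `^ q) a_lt_b p0 q0 _ _ _ _ _ _ _ _ _ _) _.
- by rewrite divr_gt0// powR_gt0.
- by rewrite divr_gt0// powR_gt0// invr_gt0.
- by move=> s c; exact: weighted_young.
- exact: continuous_subspaceW I_ab (derivative_on_continuous f1_def).
- exact: continuous_subspaceW I_ab (derivative_on_continuous f2_def).
- apply: absolutely_continuous_onS f2_ac => x /=; rewrite in_itv/=; exact: int_ab.
- move=> x xab; have Ix := int_ab x xab.
  by apply: has_derivative_within_interior Ix (f1_def _ (interior_subset Ix)).
- move=> x xab; have Ix := int_ab x xab.
  by apply: has_derivative_within_interior Ix (f2_def _ (interior_subset Ix)).
- move=> x l xab dl; apply: f3_def (interior_subset (int_ab x xab)) _.
  exact: is_derive_has_derivative_within.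
- move=> x xab.
  have t0 : 0 < (b - x) / (b - a) by rewrite divr_gt0//; lra.
  have t1 : (b - x) / (b - a) < 1 by rewrite ltr_pdivrMr//; lra.
  have := f3_Q.2 a b _ Ia Ib t0 t1.
  rewrite (_ : _ * a + _ = x); last by field; rewrite gt_eqF.
  move/le_trans; apply; rewrite le_eqVlt; apply/orP; left; apply/eqP.
  rewrite /majorant; field.
  by rewrite !gt_eqF; lra.
(* The constants agree because [2 / 3 * r ^+ 4 = (b - a) ^+ 4 / 24] when [r = (b - a) / 2]. *)
- rewrite /radius le_eqVlt; apply/orP; left; apply/eqP; field.
  by rewrite !gt_eqF// addr_gt0.
Qed.
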